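(* Let $(Q,\mathcal P)$ be a thread quiver with path category $\mathcal C$, $\mathcal I$ an ideal of $\mathcal C$, $\mathfrak P$ a valid partition and $\mathcal M$ a sample of $\mathfrak P$. Then the functor $\pi\iota:\overline{\mathcal A}^{\mathfrak P}(\mathcal M)\to\overline{\mathcal A}^{\mathfrak P}[\Sigma_{\mathfrak P}^{-1}]$ is an equivalence with quasi-inverse $\Phi$.
   Context: $k$ is an algebraically closed field. A thread quiver $(Q,\mathcal P)$ consists of a (possibly infinite) quiver $Q=(Q_0,Q_1,s,t)$ and, for every arrow $\alpha$, a (possibly empty) linearly ordered set $\mathcal P_\alpha$; $\overline{\mathcal P}_\alpha=\mathcal P_\alpha\sqcup\{\min(\alpha),\max(\alpha)\}$ is obtained by adding a new least element $\min(\alpha)$ and a new greatest element $\max(\alpha)$. Its path category $\mathcal C$ is the $k$-linear category with object set $Q_0\sqcup\bigsqcup_\alpha\mathcal P_\alpha$, where $\min(\alpha),\max(\alpha)$ are viewed as the objects $s(\alpha),t(\alpha)$ (they remain distinct elements of $\overline{\mathcal P}_\alpha$ even if $\alpha$ is a loop). For $x\le y$ in $\overline{\mathcal P}_\alpha$ there is a morphism $\eta_{y,x}=\eta_{yx}:x\to y$, with $\eta_{xx}=e_x$ the identity, $\eta_{zy}\eta_{yx}=\eta_{zx}$ for $x\le y\le z$, and $\eta_{\max(\alpha),\min(\alpha)}=\alpha$; write $\eta_{t(\alpha),x}:=\eta_{\max(\alpha),x}$ and $\eta_{x,s(\alpha)}:=\eta_{x,\min(\alpha)}$. The space $\mathrm{Hom}_{\mathcal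 C}(x,y)$ has as $k$-basis the distinct path-like elements from $x$ to $y$: the identities $e_x$, the $\eta_{yx}$, and the elements $\eta_{y,s(\beta)}\,p\,\eta_{t(\alpha),x}$ with $x\in\overline{\mathcal P}_\alpha$, $y\in\overline{\mathcal P}_\beta$ and $p$ a (possibly trivial) path of $Q$ from $t(\alpha)$ to $s(\beta)$. Composition is induced by concatenation of paths in $Q$ together with the relations $\eta_{zy}\eta_{yx}=\eta_{zx}$ for $x\le y\le z$ in $\overline{\mathcal P}_\alpha$ and $\eta_{\max(\alpha),\min(\alpha)}=\alpha$, for every arrow $\alpha$. An interval of a linearly ordered set is a nonempty subset $I$ such that $x<z<y$ with $x,y\in I$ implies $z\in I$. A valid partition $\mathfrak P$ is a partition of the objects of $\mathcal C$ such that $\{x\}$ is a cell for each $x\in Q_0$, and each $\mathcal P_\alpha$ is a union of finitely many cells that are intervals. A sample $\mathcal M$ of $\mathfrak P$ is a set of objects containing exactly one element of each cell. $\Sigma_{\mathfrak P}$ is the set of nonzero scalar multiples of the morphisms $\eta_{yx}$ with $x\le y$ in the same cell. Morphisms $f_1:x_1\to y_1$, $f_2:x_2\to y_2$ of $\mathcal C$ with $x_1,x_2$ in one cell $X$ and $y_1,y_2$ in one cell $Y$ are $\mathfrak P$-equivalent if there are $z\in X$, $w\in Y$ with $\eta_{wy_1}f_1\eta_{x_1z}=\eta_{wy_2}f_2\eta_{x_2z}$. The $\mathfrak P$-completion $\overline{\mathcal I}^{\mathfrak P}$ is the ideal of $\mathcal C$ generated by all $f$ that are $\mathfrak P$-equivalent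 to some $g\in\mathcal I$, and $\overline{\mathcal A}^{\mathfrak P}=\mathcal C/\overline{\mathcal I}^{\mathfrak P}$; $\overline{\mathcal A}^{\mathfrak P}(\mathcal M)$ is its full subcategory on $\mathcal M$, with inclusion functor $\iota$. $\Sigma_{\mathfrak P}$ (its image in $\overline{\mathcal A}^{\mathfrak P}$) admits a calculus of left fractions, and $\pi:\overline{\mathcal A}^{\mathfrak P}\to\overline{\mathcal A}^{\mathfrak P}[\Sigma_{\mathfrak P}^{-1}]$ is the $k$-linear localization functor: it inverts $\Sigma_{\mathfrak P}$, and every $k$-linear functor $F$ on $\overline{\mathcal A}^{\mathfrak P}$ inverting $\Sigma_{\mathfrak P}$ factors as $F=G\pi$ for a unique $k$-linear functor $G$. Let $\mathbf r:\overline{\mathcal A}^{\mathfrak P}\to\overline{\mathcal A}^{\mathfrak P}(\mathcal M)$ be the functor sending $x$ to the unique $s_x\in\mathcal M$ in the cell of $x$, and $p:x\to y$ to the unique (in $\overline{\mathcal A}^{\mathfrak P}$) morphism $p':s_x\to s_y$ that is $\mathfrak P$-equivalent to $p$. It inverts $\Sigma_{\mathfrak P}$, and $\Phi:\overline{\mathcal A}^{\mathfrak P}[\Sigma_{\mathfrak P}^{-1}]\to\overline{\mathcal A}^{\mathfrak P}(\mathcal M)$ is the unique functor with $\Phi\pi=\mathbf r$. *)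

(* Defs.v *)
From HB Require Import structures.
From mathcomp Require Import all_boot all_order all_algebra.
From mathcomp Require Import finmap.
From mathcomp Require Import mathcomp_extra boolp classical_sets cardinality.
From mathcomp.multinomials Require Import monalg.

Set Implicit Arguments.
Unset Strict Implicit.
Unset Printing Implicit Defensive.

Import Order.TTheory GRing.Theory.

Local Open Scope classical_set_scope.
Local Open Scope ring_scope.

Section LinearFacts.
Variables (R : nzRingType) (U V : lmodType R).

Lemma lin0 (f : U -> V) : linear f -> f 0 = 0.
Proof.
move=> lf; have := lf 1 0 0; rewrite !scale1r addr0 => /eqP.
by rewrite -subr_eq0 opprD addrA subrr sub0r oppr_eq0 => /eqP.
Qed.

Lemma linD (f : U -> V) u v : linear f -> f (u + v) = f u + f v.
Proof. by move=> lf; have := lf 1 u v; rewrite !scale1r. Qed.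

Lemma linZ (f : U -> V) a u : linear f -> f (a *: u) = a *: f u.
Proof. by move=> lf; have := lf a u 0; rewrite !addr0 (lin0 lf) addr0. Qed.

Lemma linB (f : U -> V) u v : linear f -> f (u - v) = f u - f v.
Proof. by move=> lf; rewrite -scaleN1r addrC lf scaleN1r addrC. Qed.

End LinearFacts.

Section LinearExtension.
Variables (R : nzRingType) (K : choiceType) (V : lmodType R).
Implicit Types (phi : K -> V) (f g : {malg R[K]}).

Definition lext phi f : V := \sum_(b <- msupp f) f@_b *: phi b.

Lemma lextw (d : {fset K}) phi f : (msupp f `<=` d)%fset ->
  lext phi f = \sum_(b <- d) f@_b *: phi b.
Proof.
move=> le_d; rewrite /lext (big_fset_incl _ le_d) // => b _ /mcoeff_outdom ->.
by rewrite scale0r.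
Qed.

Lemma lext_linear phi : linear (lext phi).
Proof.
move=> a f g; pose d := (msupp f `|` msupp g)%fset.
have lef : (msupp f `<=` d)%fset by exact: fsubsetUl.
have leg : (msupp g `<=` d)%fset by exact: fsubsetUr.
rewrite (lextw phi lef) (lextw phi leg) (@lextw d); last first.
  apply: (fsubset_trans (msuppD_le _ _)); apply: fsetUSS => //.
  exact: msuppZ_le.
rewrite scaler_sumr -big_split; apply: eq_bigr => b _ /=.
by rewrite mcoeffD mcoeffZ scalerDl scalerA.
Qed.

Lemma lextU phi b : lext phi << b >> = phi b.
Proof. by rewrite (lextw _ msuppU_le) big_seq_fset1 mcoeffUU scale1r. Qed.


Lemma malg_lin_ext (F G : {malg R[K]} -> V) : linear F -> linear G ->
  (forall b, F << b >> = G << b >>) -> F =1 G.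
Proof.
move=> lF lG FG f; rewrite [f]monalgE.
rewrite (big_morph F (fun u v => linD u v lF) (lin0 lF)).
rewrite (big_morph G (fun u v => linD u v lG) (lin0 lG)).
apply: eq_bigr => b _; have -> : << f@_b *g b >> = f@_b *: << b >>.
  by apply/malgP => c; rewrite mcoeffZ !mcoeffU mulrnAr mulr1.
by rewrite (linZ _ _ lF) (linZ _ _ lG) FG.
Qed.

End LinearExtension.

Lemma lext_phi_linear (R : comNzRingType) (K : choiceType) (V : lmodType R)
    a (phi psi : K -> V) f :
  lext (fun b => a *: phi b + psi b) f = a *: lext phi f + lext psi f.
Proof.
rewrite /lext scaler_sumr -big_split; apply: eq_bigr => b _ /=.
by rewrite scalerDr !scalerA mulrC.
Qed.

Record submodule (R : nzRingType) (V : lmodType R) := Submodule {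
  subm :> V -> Prop;
  subm0 : subm 0;
  submP : forall a u v, subm u -> subm v -> subm (a *: u + v) }.

Section QuotientModule.
Variables (R : nzRingType) (V : lmodType R) (S : submodule V).

Lemma submD u v : S u -> S v -> S (u + v).
Proof. by move=> Su Sv; rewrite -[u]scale1r; exact: submP. Qed.

Lemma submZ a u : S u -> S (a *: u).
Proof. by move=> Su; rewrite -[_ *: _]addr0; apply: submP => //; exact: subm0. Qed.

Lemma submN u : S u -> S (- u).
Proof. by move=> Su; rewrite -scaleN1r; exact: submZ. Qed.

Definition qrel (u v : V) : bool := `[< S (u - v) >].

Lemma qrel_refl : reflexive qrel.
Proof. by move=> u; apply/asboolP; rewrite subrr; exact: subm0. Qed.

Lemma qrel_sym : symmetric qrel.
Proof.
by move=> u v; apply: asbool_equiv_eq; split=> /submN; rewrite opprB.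
Qed.

Lemma qrel_trans : transitive qrel.
Proof.
move=> v u w /asboolP uv /asboolP vw; apply/asboolP.
by have := submD uv vw; rewrite addrA subrK.
Qed.

Canonical qrel_equiv := EquivRel qrel qrel_refl qrel_sym qrel_trans.

Definition quot : Type := {eq_quot qrel_equiv}%qT.
HB.instance Definition _ := Choice.on quot.

Definition qpi (u : V) : quot := (\pi_({eq_quot qrel_equiv}) u)%qT.
Definition qrepr (q : quot) : V :=
  repr (q : {eq_quot qrel_equiv}%qT).

Lemma qreprK q : qpi (qrepr q) = q.
Proof. exact: reprK. Qed.

Lemma qpiP u v : qpi u = qpi v <-> S (u - v).
Proof.
split=> [/eqmodP/asboolP //|Suv].
by apply/eqmodP; apply/asboolP.
Qed.

Lemma qrepr_pi u : S (qrepr (qpi u) - u).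
Proof. by apply/qpiP; rewrite qreprK. Qed.

Definition qzero := qpi 0.
Definition qadd q1 q2 := qpi (qrepr q1 + qrepr q2).
Definition qopp q := qpi (- qrepr q).
Definition qscale a q := qpi (a *: qrepr q).

Lemma qaddE u v : qadd (qpi u) (qpi v) = qpi (u + v).
Proof. by apply/qpiP; rewrite opprD addrACA; apply: submD; exact: qrepr_pi. Qed.

Lemma qoppE u : qopp (qpi u) = qpi (- u).
Proof. by apply/qpiP; rewrite -opprD; apply: submN; exact: qrepr_pi. Qed.

Lemma qscaleE a u : qscale a (qpi u) = qpi (a *: u).
Proof. by apply/qpiP; rewrite -scalerBr; apply: submZ; exact: qrepr_pi. Qed.

Lemma qaddA : associative qadd.
Proof.
move=> q1 q2 q3; rewrite -(qreprK q1) -(qreprK q2) -(qreprK q3).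
by rewrite !qaddE addrA.
Qed.

Lemma qaddC : commutative qadd.
Proof. by move=> q1 q2; rewrite /qadd addrC. Qed.

Lemma qadd0 : left_id qzero qadd.
Proof. by move=> q; rewrite -(qreprK q) qaddE add0r. Qed.

Lemma qaddN : left_inverse qzero qopp qadd.
Proof. by move=> q; rewrite -(qreprK q) qoppE qaddE addNr. Qed.

HB.instance Definition _ := GRing.isZmodule.Build quot qaddA qaddC qadd0 qaddN.

Lemma qscaleA a b q : qscale a (qscale b q) = qscale (a * b) q.
Proof. by rewrite -(qreprK q) !qscaleE scalerA. Qed.

Lemma qscale1 : left_id 1 qscale.
Proof. by move=> q; rewrite -(qreprK q) qscaleE scale1r. Qed.

Lemma qscaleDr : right_distributive qscale +%R.
Proof.
move=> a q1 q2; rewrite -(qreprK q1) -(qreprK q2).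
rewrite [_ (qpi _) (qpi _)]qaddE !qscaleE scalerDr.
by rewrite [RHS]qaddE.
Qed.

Lemma qscaleDl q : {morph qscale^~ q : a b / a + b}.
Proof.
move=> a b; rewrite -(qreprK q) !qscaleE scalerDl.
by rewrite [RHS]qaddE.
Qed.

HB.instance Definition _ :=
  GRing.Zmodule_isLmodule.Build R quot qscaleA qscale1 qscaleDr qscaleDl.

Lemma qpi_linear : linear qpi.
Proof.
by move=> a u v; rewrite -[qpi (_ + v)]qaddE -[qpi (a *: u)]qscaleE.
Qed.

Lemma qpi_eq0 u : qpi u = 0 <-> S u.
Proof. by rewrite (qpiP u 0) subr0. Qed.

End QuotientModule.

Record linCat (k : fieldType) := LinCat {
  cobj :> Type;
  chom : cobj -> cobj -> lmodType k;
  idm : forall x, chom x x;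
  ccomp : forall x y z, chom y z -> chom x y -> chom x z;
  ccomp_linl : forall x y z (f : chom x y),
    linear (fun g : chom y z => ccomp g f);
  ccomp_linr : forall x y z (g : chom y z),
    linear (fun f : chom x y => ccomp g f);
  ccompA : forall w x y z (h : chom y z) (g : chom x y) (f : chom w x),
    ccomp h (ccomp g f) = ccomp (ccomp h g) f;
  ccomp1l : forall x y (f : chom x y), ccomp (idm y) f = f;
  ccomp1r : forall x y (f : chom x y), ccomp f (idm x) = f }.

Arguments chom {k l} x y.
Arguments idm {k l} x.
Notation "g \oc f" := (ccomp g f) (at level 40, left associativity).

Record linFunctor (k : fieldType) (C D : linCat k) := LinFunctor {
  fobj :> C -> D;
  fmap : forall x y : C, chom x y -> chom (fobj x) (fobj y);
  fmap_lin : forall x y, linear (@fmap x y);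
  fmap_id : forall x, fmap (idm x) = idm (fobj x);
  fmap_comp : forall x y z (g : chom y z) (f : chom x y),
    fmap (g \oc f) = fmap g \oc fmap f }.

Arguments fmap {k C D} F [x y] f : rename.

Section Functors.
Variable k : fieldType.
Implicit Types (C D E : linCat k).

Definition idF C : linFunctor C C.
Proof. by refine (@LinFunctor k C C id (fun x y f => f) _ _ _). Defined.

Definition compF C D E (G : linFunctor D E) (F : linFunctor C D) :
  linFunctor C E.
Proof.
refine (@LinFunctor k C E (fun x => G (F x)) (fun x y f => fmap G (fmap F f)) _ _ _).
- by move=> x y a f g; rewrite !fmap_lin.
- by move=> x; rewrite !fmap_id.
- by move=> x y z g f; rewrite !fmap_comp.
Defined.

Definition is_iso C (x y : C) (f : chom x y) : Prop :=
  exists g : chom y x, g \oc f = idm x /\ f \oc g = idm y.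

Lemma iso_scale C (x : C) (c : k) : c != 0 -> is_iso (c *: idm x).
Proof.
move=> c0; exists (c^-1 *: idm x).
by rewrite !(linZ _ _ (ccomp_linr _)) !ccomp1r !scalerA mulfV ?mulVf ?scale1r.
Qed.

Lemma iso_fmap C D (F : linFunctor C D) (x y : C) (f : chom x y) :
  is_iso f -> is_iso (fmap F f).
Proof.
by case=> g [gf fg]; exists (fmap F g); rewrite -!fmap_comp gf fg !fmap_id.
Qed.

Definition nat_iso C D (F G : linFunctor C D) : Prop :=
  exists theta : forall x, chom (F x) (G x),
    (forall x, is_iso (theta x)) /\
    (forall x y (f : chom x y), theta y \oc fmap F f = fmap G f \oc theta x).

Definition quasi_inverse C D (F : linFunctor C D) (G : linFunctor D C) : Prop :=
  nat_iso (compF G F) (idF C) /\ nat_iso (compF F G) (idF D).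

Definition morph_class C := forall x y : C, set (chom x y).

Definition inverts C D (F : linFunctor C D) (S : morph_class C) : Prop :=
  forall x y (f : chom x y), S x y f -> is_iso (fmap F f).

Definition is_localization C (S : morph_class C) L (pi : linFunctor C L) : Prop :=
  inverts pi S /\
  forall D (F : linFunctor C D), inverts F S ->
    exists! G : linFunctor L D, compF G pi = F.

Definition full_sub C (M : set C) : linCat k.
Proof.
refine (@LinCat k {x : C | M x} (fun x y => chom (sval x) (sval y))
  (fun x => idm (sval x)) (fun x y z g f => g \oc f) _ _ _ _ _).
- by move=> x y z f; exact: ccomp_linl.
- by move=> x y z g; exact: ccomp_linr.
- by move=> w x y z h g f; exact: ccompA.
- by move=> x y f; exact: ccomp1l.
- by move=> x y f; exact: ccomp1r.
Defined.

Definition inclF C (M : set C) : linFunctor (full_sub M) C.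
Proof.
by refine (@LinFunctor k (full_sub M) C sval (fun x y f => f) _ _ _).
Defined.

Record cideal C := CIdeal {
  cid_sub :> forall x y : C, submodule (chom x y);
  cidl : forall x y z (g : chom y z) (f : chom x y),
    cid_sub x y f -> cid_sub x z (g \oc f);
  cidr : forall x y z (g : chom y z) (f : chom x y),
    cid_sub y z g -> cid_sub x z (g \oc f) }.

Definition gen_pred C (S : morph_class C) (x y : C) (f : chom x y) : Prop :=
  forall J : cideal C, (forall u v, S u v `<=` J u v) -> J x y f.

Definition gen_sub C (S : morph_class C) (x y : C) : submodule (chom x y).
Proof.
refine (@Submodule _ _ (@gen_pred C S x y) _ _).
- by move=> J _; exact: subm0.
- by move=> a u v Hu Hv J SJ; apply: submP; [exact: Hu|exact: Hv].
Defined.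

Definition gen_ideal C (S : morph_class C) : cideal C.
Proof.
refine (@CIdeal C (gen_sub S) _ _).
- by move=> x y z g f Hf J SJ; apply: cidl; exact: Hf.
- by move=> x y z g f Hg J SJ; apply: cidr; exact: Hg.
Defined.

Section QuotientCategory.
Variables (C : linCat k) (J : cideal C).

Definition qcomp (x y z : C) (g : quot (J y z)) (f : quot (J x y)) :
    quot (J x z) :=
  qpi (J x z) (qrepr g \oc qrepr f).

Lemma qcompE x y z (g : chom y z) (f : chom x y) :
  qcomp (qpi (J y z) g) (qpi (J x y) f) = qpi (J x z) (g \oc f).
Proof.
apply/qpiP; set g' := qrepr _; set f' := qrepr _.
have -> : g' \oc f' - g \oc f = g' \oc (f' - f) + (g' - g) \oc f.
  by rewrite (linB _ _ (ccomp_linr g')) (linB _ _ (ccomp_linl f)) addrA subrK.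
by apply: submD; [apply: cidl|apply: cidr]; exact: qrepr_pi.
Qed.

Definition quot_cat : linCat k.
Proof.
refine (@LinCat k C (fun x y => quot (J x y)) (fun x => qpi (J x x) (idm x))
  qcomp _ _ _ _ _).
- move=> x y z f a g h; rewrite -(qreprK f) -(qreprK g) -(qreprK h).
  by rewrite -qpi_linear !qcompE ccomp_linl qpi_linear.
- move=> x y z f a g h; rewrite -(qreprK f) -(qreprK g) -(qreprK h).
  by rewrite -qpi_linear !qcompE ccomp_linr qpi_linear.
- move=> w x y z h g f; rewrite -(qreprK f) -(qreprK g) -(qreprK h).
  by rewrite !qcompE ccompA.
- by move=> x y f; rewrite -(qreprK f) qcompE ccomp1l.
- by move=> x y f; rewrite -(qreprK f) qcompE ccomp1r.
Defined.

Definition quotF : linFunctor C quot_cat.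
Proof.
refine (@LinFunctor k C quot_cat id (fun x y f => qpi (J x y) f) _ _ _).
- by move=> x y; exact: qpi_linear.
- by [].
- by move=> x y z g f; rewrite [RHS]qcompE.
Defined.

Definition image_class (S : morph_class C) : morph_class quot_cat :=
  fun x y => [set fmap quotF f | f in S x y].

End QuotientCategory.

End Functors.

Arguments image_class {k C} J S x y.

Record threadQuiver (d : Order.disp_t) := ThreadQuiver {
  vert : choiceType;
  arr : choiceType;
  src : arr -> vert;
  tgt : arr -> vert;
  thr : arr -> orderType d }.

Section PathCategory.
Variables (d : Order.disp_t) (Q : threadQuiver d).

Inductive pobj := Vtx of vert Q | Pt (a : arr Q) of thr a.

(* x <= y in one P_a, or x = y a vertex.  In particular the vertex min(a) =   *)
(* max(a) of a loop a is only related to itself, by its identity.            *)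
Definition ole (x y : pobj) : bool :=
  match x, y with
  | Vtx v, Vtx w => v == w
  | Pt a p, Pt b q =>
      (a == b) && (p <= tagged_as (Tagged (@thr d Q) p) (Tagged (@thr d Q) q))%O
  | _, _ => false
  end.

Fixpoint is_path (v : vert Q) (p : seq (arr Q)) (w : vert Q) : bool :=
  if p is a :: p' then (src a == v) && is_path (tgt a) p' w else v == w.

Definition outv (x : pobj) := match x with Vtx v => v | @Pt a _ => tgt a end.
Definition inv (x : pobj) := match x with Vtx v => v | @Pt a _ => src a end.

Definition is_thr (x : pobj) := if x is Pt _ _ then true else false.

(* A path-like element from x to y is encoded by                             *)
(*  - None for eta_yx with x <= y in one P_a (the identity if x = y);         *)
(*  - Some p for eta_{y,s(b)} p eta_{t(a),x}, p a path of Q written in the     *)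
(*    order in which its arrows are traversed, where eta_{t(a),x} (resp.       *)
(*    eta_{y,s(b)}) is absent if x (resp. y) is a vertex.                      *)
(* Thus eta_xx is Some [::] for a vertex x, and the arrow a is Some [:: a].    *)
Definition is_pathlike (x : pobj) (o : option (seq (arr Q))) (y : pobj) : bool :=
  if o is Some p then is_path (outv x) p (inv y)
  else [&& is_thr x, is_thr y & ole x y].

Definition pathlike (x y : pobj) : Type :=
  {o : option (seq (arr Q)) | is_pathlike x o y}.

HB.instance Definition _ x y := Choice.on (pathlike x y).

(* eta_{t(a),x} eta_{x,s(a)} = a for x in P_a. *)
Definition through (x : pobj) : seq (arr Q) :=
  match x with Vtx _ => [::] | @Pt a _ => [:: a] end.

Definition pl_comp_code (y : pobj) (o2 o1 : option (seq (arr Q))) :=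
  match o1, o2 with
  | Some p, Some q => Some (p ++ through y ++ q)
  | None, o => o
  | o, None => o
  end.

Definition eta_code (x : pobj) : option (seq (arr Q)) :=
  if x is Vtx _ then Some [::] else None.

Variant ole_spec : pobj -> pobj -> Prop :=
  | OleVtx v : ole_spec (Vtx v) (Vtx v)
  | OlePt a (p q : thr a) of (p <= q)%O : ole_spec (Pt p) (Pt q).

Lemma ole_Pt a (p q : thr a) : ole (Pt p) (Pt q) = (p <= q)%O.
Proof. by rewrite /= eqxx tagged_asE. Qed.

Lemma oleP x y : ole x y -> ole_spec x y.
Proof.
case: x => [v|a p]; case: y => [w|b q] //=.
  by move/eqP=> ->; constructor.
by case/andP=> /eqP e; case: _ / e q => q; rewrite tagged_asE; constructor.
Qed.

Lemma ole_refl x : ole x x.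
Proof. by case: x => [v|a p] //=; rewrite ?eqxx // tagged_asE lexx. Qed.

Lemma ole_trans y x z : ole x y -> ole y z -> ole x z.
Proof.
case: x => [v|a p]; case: y => [w|b q] //=; first by move/eqP=> ->.
case/andP=> /eqP e; case: _ / e q => q; rewrite tagged_asE => pq.
case: z => [w|c r] //= /andP[/eqP e]; case: _ / e r => r.
by rewrite tagged_asE eqxx tagged_asE; exact: le_trans.
Qed.

Lemma is_path_cat v p u q w :
  is_path v p u -> is_path u q w -> is_path v (p ++ q) w.
Proof.
elim: p v => [|a p IH] v /=; first by move/eqP=> ->.
by case/andP=> -> /IH H /H.
Qed.

Lemma through_path y : is_path (inv y) (through y) (outv y).
Proof. by case: y => [v|a p] /=; rewrite ?eqxx. Qed.

Lemma thr_ole x y : is_thr x -> ole x y ->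
  [/\ outv x = outv y, inv x = inv y & through x = through y].
Proof. by move=> tx xy; case: (oleP xy) tx. Qed.

Lemma pl_comp_valid x y z o2 o1 : is_pathlike y o2 z -> is_pathlike x o1 y ->
  is_pathlike x (pl_comp_code y o2 o1) z.
Proof.
case: o1 o2 => [p|] [q|] /=.
- move=> Hq Hp; apply: (is_path_cat Hp).
  exact: (is_path_cat (through_path y) Hq).
- by case/and3P=> ty tz /(thr_ole ty)[_ <- _].
- by move=> Hq /and3P[tx ty /(thr_ole tx)[-> _ _]].
- case/and3P=> ty tz yz /and3P[tx _ xy].
  by rewrite tx tz (ole_trans xy yz).
Qed.

Definition pl_comp x y z (o2 : pathlike y z) (o1 : pathlike x y) : pathlike x z :=
  exist _ (pl_comp_code y (sval o2) (sval o1)) (pl_comp_valid (svalP o2) (svalP o1)).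

Lemma eta_valid x y : ole x y -> is_pathlike x (eta_code x) y.
Proof. by move=> xy; case: (oleP xy) => [v|a p q pq] /=; rewrite ?eqxx //= tagged_asE. Qed.

Definition pl_eta x y (xy : ole x y) : pathlike x y :=
  exist _ (eta_code x) (eta_valid xy).

Lemma pl_compA w x y z (o3 : pathlike y z) (o2 : pathlike x y) (o1 : pathlike w x) :
  pl_comp o3 (pl_comp o2 o1) = pl_comp (pl_comp o3 o2) o1.
Proof.
apply: val_inj; case: o3 o2 o1 => [[r|] H3] [[q|] H2] [[p|] H1] //=.
- by rewrite -!catA.
- by case/and3P: H2 => tx _ /(thr_ole tx)[_ _ ->].
Qed.

Lemma pl_comp1l x y (o : pathlike x y) : pl_comp (pl_eta (ole_refl y)) o = o.
Proof.
apply: val_inj; case: o => [[p|] H] /=; case: y H => [v|a q] //=.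
- by rewrite cats0.
- by rewrite andbF.
Qed.

Lemma pl_comp1r x y (o : pathlike x y) : pl_comp o (pl_eta (ole_refl x)) = o.
Proof. by apply: val_inj; case: o => [[p|] H] /=; case: x H. Qed.

Variable k : fieldType.

Definition phom (x y : pobj) := {malg k[pathlike x y]}.

Definition pcomp x y z (g : phom y z) (f : phom x y) : phom x z :=
  lext (fun o1 => lext (fun o2 => << pl_comp o2 o1 >>) g) f.

Lemma pcomp_linr x y z (g : phom y z) : linear (fun f : phom x y => pcomp g f).
Proof. exact: lext_linear. Qed.

Lemma pcomp_linl x y z (f : phom x y) : linear (fun g : phom y z => pcomp g f).
Proof.
move=> a g h; rewrite /pcomp -lext_phi_linear.
by apply: eq_bigr => o _; rewrite lext_linear.
Qed.

Lemma pcompU x y z (o2 : pathlike y z) (o1 : pathlike x y) :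
  pcomp << o2 >> << o1 >> = << pl_comp o2 o1 >> :> phom x z.
Proof. by rewrite /pcomp !lextU. Qed.

Definition pathCat : linCat k.
Proof.
refine (@LinCat k pobj phom (fun x => << pl_eta (ole_refl x) >>) pcomp
  pcomp_linl pcomp_linr _ _ _).
- move=> w x y z h g f.
  pose H1 := pcomp_linr; pose H2 := pcomp_linl.
  move: f; apply: malg_lin_ext => [a u v|a u v|o1].
  + by rewrite !H1.
  + by rewrite !H1.
  move: g; apply: malg_lin_ext => [a u v|a u v|o2].
  + by rewrite H2 H1.
  + by rewrite H1 H2.
  move: h; apply: malg_lin_ext => [a u v|a u v|o3].
  + by rewrite H2.
  + by rewrite !H2.
  by rewrite !pcompU pl_compA.
- move=> x y; apply: malg_lin_ext => // [|o]; first exact: pcomp_linr.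
  by rewrite pcompU pl_comp1l.
- move=> x y; apply: malg_lin_ext => // [|o]; first exact: pcomp_linl.
  by rewrite pcompU pl_comp1r.
Defined.

Definition eta (x y : pathCat) (xy : ole x y) : chom x y := << pl_eta xy >>.

Lemma arrow_valid (a : arr Q) :
  is_pathlike (Vtx (src a)) (Some [:: a]) (Vtx (tgt a)).
Proof. by rewrite /= !eqxx. Qed.

Lemma eta_tgt_valid (a : arr Q) (p : thr a) :
  is_pathlike (Pt p) (Some [::]) (Vtx (tgt a)).
Proof. by rewrite /=. Qed.

Lemma eta_src_valid (a : arr Q) (p : thr a) :
  is_pathlike (Vtx (src a)) (Some [::]) (Pt p).
Proof. by rewrite /=. Qed.

Definition pl_arrow a : pathlike (Vtx (src a)) (Vtx (tgt a)) :=
  Sub (Some [:: a]) (arrow_valid a).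
Definition pl_eta_tgt a (p : thr a) : pathlike (Pt p) (Vtx (tgt a)) :=
  Sub (Some [::]) (eta_tgt_valid p).
Definition pl_eta_src a (p : thr a) : pathlike (Vtx (src a)) (Pt p) :=
  Sub (Some [::]) (eta_src_valid p).

Definition arrow (a : arr Q) : chom (Vtx (src a) : pathCat) (Vtx (tgt a)) :=
  << pl_arrow a >>.

(* eta_{t(a),x} and eta_{x,s(a)} for x in P_a. *)
Definition eta_tgt a (p : thr a) : chom (Pt p : pathCat) (Vtx (tgt a)) :=
  << pl_eta_tgt p >>.
Definition eta_src a (p : thr a) : chom (Vtx (src a) : pathCat) (Pt p) :=
  << pl_eta_src p >>.

Lemma eta_eta (x y z : pathCat) (xy : ole x y) (yz : ole y z) :
  eta yz \oc eta xy = eta (ole_trans xy yz).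
Proof.
rewrite /eta [LHS]pcompU; congr << _ >>; apply: val_inj => /=.
by case: (oleP xy) yz => // v yz.
Qed.

Lemma eta_idm (x : pathCat) : eta (ole_refl x) = idm x.
Proof. by []. Qed.

Lemma eta_tgt_eta (a : arr Q) (p q : thr a) (pq : ole (Pt p) (Pt q)) :
  eta_tgt q \oc eta pq = eta_tgt p.
Proof. by rewrite [LHS]pcompU; congr << _ >>; apply: val_inj. Qed.

Lemma eta_eta_src (a : arr Q) (p q : thr a) (pq : ole (Pt p) (Pt q)) :
  eta pq \oc eta_src p = eta_src q.
Proof. by rewrite [LHS]pcompU; congr << _ >>; apply: val_inj. Qed.

Lemma eta_tgt_src (a : arr Q) (p : thr a) : eta_tgt p \oc eta_src p = arrow a.
Proof. by rewrite [LHS]pcompU; congr << _ >>; apply: val_inj. Qed.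

(* Forgets the end points of the path-like elements; P-equivalence amounts to *)
(* having the same image under code, see pequivP.                             *)
Definition code (x y : pathCat) (f : chom x y) : {malg k[option (seq (arr Q))]} :=
  lext (fun o : pathlike x y => << sval o >>) f.

Lemma code_linear x y : linear (@code x y).
Proof. exact: lext_linear. Qed.

Lemma codeU x y (o : pathlike x y) : @code x y << o >> = << sval o >>.
Proof. exact: lextU. Qed.

Lemma code_inj x y : injective (@code x y).
Proof.
pose dec c : phom x y := if insub c is Some o then << (o : pathlike x y) >> else 0.
apply: (@can_inj _ _ _ (lext dec)) => f; move: f.
apply: (malg_lin_ext (F := fun f => lext dec (code f)) (G := fun f => f)) => //.
- by move=> a u v; rewrite code_linear lext_linear.
by move=> o; rewrite codeU lextU /dec valK.
Qed.

Lemma code_eta (x y z w : pathCat) (zx : ole z x) (yw : ole y w) (f : chom x y) :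
  code (eta yw \oc f \oc eta zx) = code f.
Proof.
move: f; apply: malg_lin_ext => [a u v|a u v|o].
- by rewrite ccomp_linr ccomp_linl code_linear.
- by rewrite code_linear.
rewrite {1}/ccomp /= !pcompU !codeU; congr << _ >> => /=.
case: o => [[p|] H] /=.
  by case: (oleP zx) => [v|a q r _]; case: (oleP yw) => [v'|a' q' r' _] //=; rewrite ?cats0.
by case: (oleP zx) H => [v|a q r _]; case: (oleP yw) => [v'|a' q' r' _] //=.
Qed.

End PathCategory.

Arguments eta {d Q k x y} xy.

Section ValidPartition.
Variables (d : Order.disp_t) (Q : threadQuiver d).

Definition order_interval (T : orderType d) (A : set T) : Prop :=
  A !=set0 /\ forall x y z, A x -> A y -> (x < z)%O -> (z < y)%O -> A z.

Definition valid_partition (PP : set (set (pobj Q))) : Prop :=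
  [/\ partition PP id setT,
      forall v : vert Q, PP [set Vtx v] &
      forall a : arr Q, exists F : set (set (pobj Q)),
        [/\ finite_set F, F `<=` PP,
            \bigcup_(X in F) X = range (@Pt d Q a) &
            forall X, F X -> order_interval (@Pt d Q a @^-1` X)]].

Definition sample (PP : set (set (pobj Q))) (M : set (pobj Q)) : Prop :=
  forall X, PP X -> exists! x, X x /\ M x.

Definition same_cell (PP : set (set (pobj Q))) (x y : pobj Q) : Prop :=
  exists X, [/\ PP X, X x & X y].

Variable k : fieldType.
Local Notation C := (pathCat Q k).

Definition Sigma (PP : set (set (pobj Q))) : morph_class C :=
  fun x y => [set f | exists (xy : ole x y) (c : k),
                        [/\ same_cell PP x y, c != 0 & f = c *: eta xy]].

Definition pequiv (PP : set (set (pobj Q))) (x1 y1 : C) (f1 : chom x1 y1)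
    (x2 y2 : C) (f2 : chom x2 y2) : Prop :=
  [/\ same_cell PP x1 x2, same_cell PP y1 y2 &
    exists (z w : C) (zx1 : ole z x1) (zx2 : ole z x2)
           (yw1 : ole y1 w) (yw2 : ole y2 w),
      [/\ same_cell PP x1 z, same_cell PP y1 w &
          eta yw1 \oc f1 \oc eta zx1 = eta yw2 \oc f2 \oc eta zx2]].

Definition completion (I : cideal C) (PP : set (set (pobj Q))) : cideal C :=
  gen_ideal (fun x y => [set f : chom x y |
    exists (x' y' : C) (g : chom x' y'), I x' y' g /\ pequiv PP f g]).

Definition Abar (I : cideal C) (PP : set (set (pobj Q))) : linCat k :=
  quot_cat (completion I PP).

Definition Abar_proj (I : cideal C) (PP : set (set (pobj Q))) :
    linFunctor C (Abar I PP) :=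
  quotF (completion I PP).

Definition Sigma_bar (I : cideal C) (PP : set (set (pobj Q))) :
    morph_class (Abar I PP) :=
  image_class (completion I PP) (Sigma PP).

Definition is_retraction (I : cideal C) (PP : set (set (pobj Q)))
    (M : set (Abar I PP)) (r : linFunctor (Abar I PP) (full_sub M)) : Prop :=
  (forall x, same_cell PP x (sval (r x))) /\
  forall (x y : C) (p : chom x y),
    exists p' : @chom k C (sval (r x)) (sval (r y)),
      pequiv PP p p' /\ fmap r (fmap (Abar_proj I PP) p) = fmap (Abar_proj I PP) p'.

End ValidPartition.

Arguments Sigma {d Q} k PP x y.
Arguments Sigma_bar {d Q k} I PP x y.
Arguments completion {d Q k} I PP.
Arguments Abar_proj {d Q k} I PP.

Section Retraction.
Variables (d : Order.disp_t) (Q : threadQuiver d) (k : fieldType).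
Local Notation C := (pathCat Q k).
Variables (PP : set (set (pobj Q))) (hPP : valid_partition PP).

Lemma cell_eq X Y x : PP X -> PP Y -> X x -> Y x -> X = Y.
Proof.
by case: hPP => -[_ tPP _] _ _ PX PY Xx Yx; apply: tPP => //; exists x.
Qed.

Lemma same_cell_refl x : same_cell PP x x.
Proof.
case: hPP => -[cPP _ _] _ _; have : setT x by [].
by rewrite -cPP => -[X PX Xx]; exists X.
Qed.

Lemma same_cell_sym x y : same_cell PP x y -> same_cell PP y x.
Proof. by case=> X [PX Xx Xy]; exists X. Qed.

Lemma same_cell_trans x y z :
  same_cell PP x y -> same_cell PP y z -> same_cell PP x z.
Proof.
case=> X [PX Xx Xy] [Y [PY Yy Yz]]; exists X; split=> //.
by rewrite (cell_eq PX PY Xy Yy).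
Qed.

Lemma same_Vtx v y : same_cell PP (Vtx v) y -> y = Vtx v.
Proof.
case: hPP => _ hv _ [X [PX Xv Xy]].
by have XE := cell_eq PX (hv v) Xv erefl; move: Xy; rewrite XE.
Qed.

Lemma same_Pt a (p : thr a) y : same_cell PP (Pt p) y ->
  exists q : thr a, y = Pt q.
Proof.
case: hPP => _ _ ha [X [PX Xx Xy]].
have [F [_ FP UF _]] := ha a.
have : range (@Pt d Q a) (Pt p) by exists p.
rewrite -UF => -[Y FY Yp].
have : range (@Pt d Q a) y.
  by rewrite -UF; exists Y => //; rewrite -(cell_eq PX (FP _ FY) Xx Yp).
by case=> q _ <-; exists q.
Qed.

Lemma same_total x y : same_cell PP x y -> ole x y \/ ole y x.
Proof.
case: x => [v /same_Vtx ->|a p /same_Pt[q ->]]; first by left; exact: ole_refl.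
by rewrite !ole_Pt; apply/orP; exact: le_total.
Qed.

Lemma cell_conv a (p q r : thr a) : same_cell PP (Pt p) (Pt q) ->
  (p < r)%O -> (r < q)%O -> same_cell PP (Pt p) (Pt r).
Proof.
case: hPP => _ _ ha [X [PX Xp Xq]] pr rq.
have [F [_ FP UF FI]] := ha a.
have : range (@Pt d Q a) (Pt p) by exists p.
rewrite -UF => -[Y FY Yp].
have XY := cell_eq PX (FP _ FY) Xp Yp; rewrite -XY in FY.
exists X; split=> //; have [_ H] := FI _ FY.
exact: (H p q r).
Qed.

Lemma pequivP (x1 y1 : C) (f1 : chom x1 y1) (x2 y2 : C) (f2 : chom x2 y2) :
  pequiv PP f1 f2 <->
  [/\ same_cell PP x1 x2, same_cell PP y1 y2 & code f1 = code f2].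
Proof.
split=> [[sx sy [z [w [zx1 [zx2 [yw1 [yw2 [_ _ E]]]]]]]]|[sx sy E]].
  by split=> //; rewrite -(code_eta zx1 yw1) E code_eta.
split=> //.
have [z [zx1 zx2 sz]] : exists z, [/\ ole z x1, ole z x2 & same_cell PP x1 z].
  case: (same_total sx) => H.
    by exists x1; split=> //; [exact: ole_refl|exact: same_cell_refl].
  by exists x2; split=> //; exact: ole_refl.
have [w [yw1 yw2 sw]] : exists w, [/\ ole y1 w, ole y2 w & same_cell PP y1 w].
  case: (same_total sy) => H.
    by exists y2; split=> //; exact: ole_refl.
  by exists y1; split=> //; [exact: ole_refl|exact: same_cell_refl].
exists z, w, zx1, zx2, yw1, yw2; split=> //.
by apply: code_inj; rewrite !code_eta.
Qed.

Lemma same_out x y : same_cell PP x y ->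
  [/\ outv x = outv y, inv x = inv y, through x = through y,
      is_thr x = is_thr y & eta_code x = eta_code y].
Proof. by case: x => [v /same_Vtx ->|a p /same_Pt[q ->]]. Qed.

Section Transfer.
Variable s : C -> C.
Hypothesis s_same : forall x, same_cell PP x (s x).
Hypothesis s_eq : forall x y, same_cell PP x y -> s x = s y.

Lemma s_le x y : ole x y -> ole (s x) (s y).
Proof.
move=> xy; have [/s_eq ->|nxy] := pselect (same_cell PP x y); first exact: ole_refl.
have := s_same y; have := s_same x.
case: (oleP xy) nxy => [v|a p q pq] nxy.
  by case: nxy; exact: same_cell_refl.
move=> pu; move: (pu) => /same_Pt[p' E]; rewrite E in pu *.
move=> qv; move: (qv) => /same_Pt[q' E']; rewrite E' in qv *.
rewrite ole_Pt leNgt; apply/negP => q'p'; apply: nxy.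
have [pq'|q'p|->] := ltgtP p q'.
- exact: same_cell_trans (cell_conv pu pq' q'p') (same_cell_sym qv).
- have [qp|qp|->] := ltgtP q p; last exact: same_cell_refl.
    by move: pq; rewrite leNgt qp.
  exact: same_cell_sym (same_cell_trans qv (cell_conv (same_cell_sym qv) q'p qp)).
- exact: same_cell_sym.
Qed.

Lemma tr_valid x y (o : pathlike x y) : is_pathlike (s x) (sval o) (s y).
Proof.
have [Ox Ix _ tx _] := same_out (s_same x); have [Oy Iy _ ty _] := same_out (s_same y).
case: o => [[p|]] /=; first by rewrite -Ox -Iy.
by case/and3P=> ? ? /s_le ->; rewrite -tx -ty andbT; apply/andP.
Qed.

Definition pl_tr x y (o : pathlike x y) : pathlike (s x) (s y) :=
  exist _ (sval o) (tr_valid o).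

Definition tr (x y : C) (f : chom x y) : chom (s x) (s y) :=
  lext (fun o => << pl_tr o >>) f.

Lemma tr_linear x y : linear (@tr x y).
Proof. exact: lext_linear. Qed.

Lemma code_tr x y (f : chom x y) : code (tr f) = code f.
Proof.
move: f; apply: malg_lin_ext => [a u v|a u v|o].
- by rewrite tr_linear code_linear.
- by rewrite code_linear.
by rewrite /tr lextU !codeU.
Qed.

Lemma pequiv_tr x y (f : chom x y) : pequiv PP f (tr f).
Proof. by apply/pequivP; split=> //; rewrite code_tr. Qed.

Lemma tr_id x : tr (idm x) = idm (s x).
Proof.
apply: code_inj; rewrite code_tr !codeU /=.
by case: (same_out (s_same x)) => _ _ _ _ ->.
Qed.

Lemma tr_comp x y z (g : chom y z) (f : chom x y) : tr (g \oc f) = tr g \oc tr f.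
Proof.
move: f; apply: malg_lin_ext => [a u v|a u v|o1].
- by rewrite ccomp_linr tr_linear.
- by rewrite tr_linear ccomp_linr.
move: g; apply: malg_lin_ext => [a u v|a u v|o2].
- by rewrite ccomp_linl tr_linear.
- by rewrite tr_linear ccomp_linl.
rewrite /tr [X in lext _ X]pcompU !lextU [RHS]pcompU; congr << _ >>.
apply: val_inj => /=; rewrite /pl_comp_code.
by case: (same_out (s_same y)) => _ _ -> _ _.
Qed.

Variable I : cideal C.

Definition tr_sub (x y : C) : submodule (chom x y).
Proof.
refine (@Submodule _ _ (fun f => completion I PP (s x) (s y) (tr f)) _ _).
- by rewrite (lin0 (@tr_linear x y)); exact: subm0.
- by move=> a u v Hu Hv; rewrite tr_linear; exact: submP.
Defined.

Definition tr_ideal : cideal C.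
Proof.
refine (@CIdeal k C tr_sub _ _).
- move=> x y z g f Hf; change (completion I PP (s x) (s z) (tr (g \oc f))).
  by rewrite tr_comp; apply: cidl.
- move=> x y z g f Hg; change (completion I PP (s x) (s z) (tr (g \oc f))).
  by rewrite tr_comp; apply: cidr.
Defined.

Lemma tr_completion x y (f : chom x y) :
  completion I PP x y f -> completion I PP (s x) (s y) (tr f).
Proof.
move=> /(_ tr_ideal); apply=> {}x {}y {}f [x' [y' [g [Ig /pequivP[sx sy E]]]]].
move=> J; apply; exists x', y', g; split=> //; apply/pequivP; split.
- exact: same_cell_trans (same_cell_sym (s_same x)) sx.
- exact: same_cell_trans (same_cell_sym (s_same y)) sy.
- by rewrite code_tr.
Qed.

End Transfer.

Variables (I : cideal C) (M : set (pobj Q)) (hM : sample PP M).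

Lemma sample_pick x : {y | same_cell PP x y /\ M y}.
Proof.
apply: cid; have [X [PX Xx _]] := same_cell_refl x.
by have [y [[Xy My] _]] := hM PX; exists y; split=> //; exists X.
Qed.

Lemma sample_uniq x y : same_cell PP x y -> M x -> M y -> x = y.
Proof.
by case=> X [PX Xx Xy] Mx My; have [z [_ H]] := hM PX; rewrite -(H x) // (H y).
Qed.

Let s (x : C) : C := sval (sample_pick x).

Let s_same x : same_cell PP x (s x).
Proof. by rewrite /s; case: (sample_pick x) => ? []. Qed.

Let s_M x : M (s x).
Proof. by rewrite /s; case: (sample_pick x) => ? []. Qed.

Let s_eq x y : same_cell PP x y -> s x = s y.
Proof.
move=> xy; apply: sample_uniq => //.
by apply: same_cell_trans (same_cell_trans _ xy) _ => //; exact: same_cell_sym.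
Qed.

Lemma retraction_exists :
  exists r : linFunctor (Abar I PP) (full_sub (M : set (Abar I PP))),
    is_retraction r.
Proof.
pose tr' := tr s_same s_eq.
pose CI := completion I PP.
pose rh (x y : Abar I PP) (q : chom x y) : @chom k (Abar I PP) (s x) (s y) :=
  qpi (CI (s x) (s y)) (@tr' x y (qrepr q)).
have rhE x y (f : @chom k C x y) : @rh x y (qpi (CI x y) f) = qpi (CI (s x) (s y)) (tr' _ _ f).
  apply/qpiP; rewrite -(linB _ _ (@tr_linear _ s_same s_eq x y)).
  by apply: tr_completion; exact: qrepr_pi.
pose ro (x : Abar I PP) : full_sub (M : set (Abar I PP)) := exist _ (s x) (s_M x).
have H1 x y : linear (@rh x y).
  move=> a u v; rewrite -(qreprK u) -(qreprK v) -qpi_linear !rhE.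
  by rewrite /tr' tr_linear qpi_linear.
have H2 x : @rh x x (idm x) = idm (s x : Abar I PP).
  by rewrite [LHS]rhE /tr' tr_id.
have H3 x y z (g : @chom k (Abar I PP) y z) (f : @chom k (Abar I PP) x y) :
    @rh x z (g \oc f) = rh _ _ g \oc rh _ _ f.
  rewrite -(qreprK f) -(qreprK g) [X in rh _ _ X]qcompE !rhE [RHS]qcompE.
  by rewrite /tr' tr_comp.
exists (@LinFunctor k (Abar I PP) (full_sub (M : set (Abar I PP))) ro rh H1 H2 H3).
split=> [x|x y p]; first exact: s_same.
exists (tr' _ _ p); split; first exact: pequiv_tr.
exact: rhE.
Qed.

Lemma retraction_unique
    (r1 r2 : linFunctor (Abar I PP) (full_sub (M : set (Abar I PP)))) :
  is_retraction r1 -> is_retraction r2 -> r1 = r2.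
Proof.
case: r1 r2 => [o1 h1 A1 A2 A3] [o2 h2 B1 B2 B3] [/= c1 e1] [/= c2 e2].
have E : o1 = o2.
  apply/funext => x; move: (o1 x) (o2 x) (c1 x) (c2 x) => [u Mu] [v Mv] /= cu cv.
  have uv : u = v.
    by apply: sample_uniq => //; exact: same_cell_trans (same_cell_sym cu) cv.
  by subst v; congr exist; exact: Prop_irrelevance.
subst o2; have E : h1 = h2.
  apply/functional_extensionality_dep => x; apply/functional_extensionality_dep => y.
  apply/funext => q; rewrite -(qreprK q).
  have [p1 [/pequivP[_ _ E1] /= F1]] := e1 x y (qrepr q).
  have [p2 [/pequivP[_ _ E2] /= F2]] := e2 x y (qrepr q).
  have p12 : p1 = p2 by apply: code_inj; rewrite -E1 -E2.
  by rewrite F1 F2 p12.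
by subst h2; congr LinFunctor; exact: Prop_irrelevance.
Qed.

(* There is exactly one such functor, by retraction_unique. *)
Definition retraction : linFunctor (Abar I PP) (full_sub (M : set (Abar I PP))) :=
  sval (cid retraction_exists).

Lemma retractionP : is_retraction retraction.
Proof. exact: svalP (cid retraction_exists). Qed.

Lemma retraction_inverts : inverts retraction (Sigma_bar I PP).
Proof.
move=> x y _ [f [xy [c [sxy c0 ->]]] <-].
have [rs /(_ x y (c *: eta xy))[p' [/pequivP[_ _ E] ->]]] := retractionP.
move: (rs x) (rs y); move: p' E.
move: (retraction x) (retraction y) => [u Mu] [v Mv] /= p' E su sv.
have uv : u = v.
  apply: sample_uniq => //.
  exact: same_cell_trans (same_cell_sym su) (same_cell_trans sxy sv).
subst v; have [_ _ _ _ Eu] := same_out su.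
have p'E : p' = c *: idm (u : C).
  apply: code_inj; rewrite -E !(linZ _ _ (@code_linear _ _ _ _ _)) !codeU /=.
  by rewrite Eu.
have := iso_fmap (Abar_proj I PP) (iso_scale (u : C) c0).
by rewrite -p'E => -[g gP]; exists g.
Qed.

Variables (L : linCat k) (pi : linFunctor (Abar I PP) L).
Hypothesis hpi : is_localization (Sigma_bar I PP) pi.

Definition Phi : linFunctor L (full_sub (M : set (Abar I PP))) :=
  sval (cid (hpi.2 _ _ retraction_inverts)).

Lemma PhiP : compF Phi pi = retraction.
Proof. by rewrite /Phi; case: cid => ? []. Qed.

Lemma Phi_unique (G : linFunctor L (full_sub (M : set (Abar I PP)))) :
  compF G pi = retraction -> G = Phi.
Proof. by rewrite /Phi; case: cid => F [_ H] /= /H. Qed.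

End Retraction.

(* Main.v *)
(** In [L] the images of the [eta_yx] with [x <= y] in one cell are invertible,
    and P-equivalent morphisms agree after composing with such elements on both
    sides. Hence the isomorphisms [pi x1 -> pi x2] they induce for [x1], [x2] in
    one cell are compatible with [pi] on P-equivalent morphisms, which gives a
    natural isomorphism from [pi iota r = pi iota Phi pi] to [pi]. It is a
    functor from [Abar] to the category of isomorphisms of [L] that inverts
    Sigma; by the universal property of [pi] it factors through [L], and the
    factorization is a natural isomorphism from [pi iota Phi] to the identity. *)
Require Import Defs.
From mathcomp Require Import all_boot all_order all_algebra.
From mathcomp Require Import boolp classical_sets.

Set Implicit Arguments.
Unset Strict Implicit.
Unset Printing Implicit Defensive.

Import GRing.Theory.

Local Open Scope ring_scope.

Section LinearCategories.
Variable k : fieldType.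
Implicit Types C D E L : linCat k.

Lemma iso_cancel_left C (x y z : C) (h : chom y z) (f g : chom x y) :
  is_iso h -> h \oc f = h \oc g -> f = g.
Proof.
by case=> h' [h'h _] E; rewrite -[f]ccomp1l -h'h -ccompA E ccompA h'h ccomp1l.
Qed.

Lemma iso_cancel_right C (x y z : C) (h : chom x y) (f g : chom y z) :
  is_iso h -> f \oc h = g \oc h -> f = g.
Proof.
by case=> h' [_ hh'] E; rewrite -[f]ccomp1r -hh' ccompA E -ccompA hh' ccomp1r.
Qed.

Lemma functor_ext C D (o : C -> D)
    (h1 h2 : forall x y : C, chom x y -> chom (o x) (o y)) A1 A2 A3 B1 B2 B3 :
  (forall x y f, h1 x y f = h2 x y f) ->
  @LinFunctor k C D o h1 A1 A2 A3 = @LinFunctor k C D o h2 B1 B2 B3.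
Proof.
move=> E; have {}E : h1 = h2.
  by do 2![apply/functional_extensionality_dep => ?]; apply/funext => f; exact: E.
by subst h2; congr LinFunctor; exact: Prop_irrelevance.
Qed.

Lemma functor_eta C D (F : linFunctor C D) A1 A2 A3 :
  @LinFunctor k C D F (@fmap _ _ _ F) A1 A2 A3 = F.
Proof. by case: F A1 A2 A3 => o h *; exact: functor_ext. Qed.

Lemma compFA C D E L (H : linFunctor E L) (G : linFunctor D E)
    (F : linFunctor C D) : compF H (compF G F) = compF (compF H G) F.
Proof. exact: functor_ext. Qed.

Lemma compF_inverts C D E (S : morph_class C) (G : linFunctor D E)
    (F : linFunctor C D) : inverts F S -> inverts (compF G F) S.
Proof. by move=> FS x y f Sf; apply: (iso_fmap G); exact: FS. Qed.

(** The inverse is stored as data, since [domF] conjugates with it. *)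
Record isoArrow C := IsoArrow {
  iso_dom : C;
  iso_cod : C;
  iso_map : chom iso_dom iso_cod;
  iso_inv : chom iso_cod iso_dom;
  iso_mapK : iso_inv \oc iso_map = idm iso_dom;
  iso_invK : iso_map \oc iso_inv = idm iso_cod }.

(* A commutative square between two isomorphisms is determined by its
   codomain side, so that side alone serves as the space of morphisms. *)
Definition isoCat C : linCat k.
Proof.
refine (@LinCat k (isoArrow C) (fun u v => chom (iso_cod u) (iso_cod v))
  (fun u => idm (iso_cod u)) (fun u v w g f => g \oc f) _ _ _ _ _).
- by move=> u v w f; exact: ccomp_linl.
- by move=> u v w g; exact: ccomp_linr.
- by move=> t u v w h g f; exact: ccompA.
- by move=> u v f; exact: ccomp1l.
- by move=> u v f; exact: ccomp1r.
Defined.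

Definition codF C : linFunctor (isoCat C) C.
Proof.
by refine (@LinFunctor k (isoCat C) C (@iso_cod C) (fun u v f => f) _ _ _).
Defined.

(** Commutativity of the square forces its domain side to be this conjugate of the codomain side. *)
Definition domF C : linFunctor (isoCat C) C.
Proof.
refine (@LinFunctor k (isoCat C) C (@iso_dom C)
  (fun u v f => iso_inv v \oc f \oc iso_map u) _ _ _).
- by move=> u v a f g; rewrite ccomp_linr ccomp_linl.
- by move=> u; rewrite ccomp1r iso_mapK.
- move=> u v w g f; rewrite -!ccompA; congr (_ \oc (_ \oc _)).
  by rewrite !ccompA iso_invK ccomp1l.
Defined.

Lemma nat_iso_dom_cod C : nat_iso (domF C) (codF C).
Proof.
exists (@iso_map C); split=> [u|u v f].
  by exists (iso_inv u); rewrite iso_mapK iso_invK.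
by rewrite /= !ccompA iso_invK ccomp1l.
Qed.

Lemma nat_iso_compr C D E (F G : linFunctor D E) (H : linFunctor C D) :
  nat_iso F G -> nat_iso (compF F H) (compF G H).
Proof.
case=> t [ti tn]; exists (fun x => t (H x)).
by split=> [x|x y f]; [exact: ti|exact: tn].
Qed.

Section Localization.
Variables (C L : linCat k) (S : morph_class C) (pi : linFunctor C L).
Hypothesis piP : is_localization S pi.

(** [compF G pi] inverts [S] because [pi] does, so its factorization through [pi] is unique. *)
Lemma localization_ext D (F G : linFunctor L D) :
  compF F pi = compF G pi -> F = G.
Proof.
move=> E; have [H [_ HU]] := piP.2 _ _ (compF_inverts G piP.1).
by rewrite -(HU F) // -(HU G).
Qed.

Lemma localization_nat_iso (F : linFunctor L L) :
  nat_iso (compF F pi) pi -> nat_iso F (idF L).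
Proof.
case=> t [ti tn].
have [t' t'K] : {t' : forall x, chom (pi x) (F (pi x)) &
    forall x, t' x \oc t x = idm _ /\ t x \oc t' x = idm _}.
  by exists (fun x => sval (cid (ti x))) => x; case: cid.
pose Ho x : isoCat L := IsoArrow (t'K x).1 (t'K x).2.
pose H := @LinFunctor k C (isoCat L) Ho (fun x y f => fmap pi f)
  (@fmap_lin _ _ _ pi) (@fmap_id _ _ _ pi) (@fmap_comp _ _ _ pi).
(* An inverse of the codomain side is already an inverse in [isoCat L]. *)
have HS : inverts H S.
  by move=> x y f /piP.1[g gP]; exists g.
have [G [GH _]] := piP.2 _ _ HS.
have <- : compF (domF L) G = F.
  apply: localization_ext; rewrite -compFA GH; apply: functor_ext => x y f /=.
  (* Naturality of [t] turns the conjugate of [fmap pi f] into [fmap F (fmap pi f)]. *)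
  by rewrite -ccompA -tn ccompA (t'K y).1 ccomp1l.
have <- : compF (codF L) G = idF L.
  apply: localization_ext; rewrite -compFA GH.
  (* Both sides have the object and morphism maps of [pi]. *)
  by transitivity pi; [|apply: esym]; exact: (functor_eta (F := pi)).
exact/nat_iso_compr/nat_iso_dom_cod.
Qed.

End Localization.

End LinearCategories.

Section ThreadQuiver.
Variables (d : Order.disp_t) (Q : threadQuiver d) (k : fieldType).
Local Notation C := (pathCat Q k).
Variables (PP : set (set (pobj Q))) (hPP : valid_partition PP).

Section CellComparison.
Variables (D : linCat k) (F : linFunctor C D).
Hypothesis F_inverts : inverts F (Sigma k PP).

Lemma iso_eta (x y : C) (xy : ole x y) : same_cell PP x y ->
  is_iso (fmap F (eta xy)).
Proof.
move=> sxy; apply: F_inverts; exists xy, 1; split=> //; first exact: oner_neq0.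
by rewrite scale1r.
Qed.

(** Stated through a common lower and a common upper bound in the cell, this does not depend on
    which of [x1], [x2] is smaller. *)
Definition cell_comparison (x1 x2 : C) (t : chom (F x1) (F x2)) : Prop :=
  (exists (z : C) (zx1 : ole z x1) (zx2 : ole z x2),
    same_cell PP z x1 /\ t \oc fmap F (eta zx1) = fmap F (eta zx2)) /\
  (exists (w : C) (xw1 : ole x1 w) (xw2 : ole x2 w),
    same_cell PP x2 w /\ fmap F (eta xw2) \oc t = fmap F (eta xw1)).

Lemma cell_comparison_exists (x1 x2 : C) : same_cell PP x1 x2 ->
  {t : chom (F x1) (F x2) | is_iso t /\ cell_comparison t}.
Proof.
move=> s12; apply: cid; have [le12|le21] := same_total hPP s12.
  exists (fmap F (eta le12)); split; first exact: iso_eta.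
  split; [exists x1, (ole_refl x1), le12|exists x2, le12, (ole_refl x2)].
    by split; [exact: same_cell_refl|rewrite eta_idm fmap_id ccomp1r].
  by split; [exact: same_cell_refl|rewrite eta_idm fmap_id ccomp1l].
(* When [x2] lies below [x1], the comparison is the inverse of the image of eta. *)
have [t [tK Kt]] := iso_eta le21 (same_cell_sym s12).
exists t; split; first by exists (fmap F (eta le21)).
split; [exists x2, le21, (ole_refl x2)|exists x1, (ole_refl x1), le21].
  by split; [exact: same_cell_sym|rewrite eta_idm fmap_id].
by split; [exact: same_cell_sym|rewrite eta_idm fmap_id].
Qed.

(** Composing with invertible images of eta on both sides, via the lower bound for [tx] and the
    upper bound for [ty], removes both comparisons. What remains are the images of two parallel
    morphisms with the same code. *)
Lemma cell_comparison_natural (x1 x2 y1 y2 : C) (f1 : chom x1 y1)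
    (f2 : chom x2 y2) (tx : chom (F x1) (F x2)) (ty : chom (F y1) (F y2)) :
  cell_comparison tx -> cell_comparison ty -> code f1 = code f2 ->
  ty \oc fmap F f1 = fmap F f2 \oc tx.
Proof.
move=> [[z [zx1 [zx2 [szx Ez]]]] _] [_ [w [yw1 [yw2 [syw Ew]]]]] E12.
apply: (iso_cancel_left (iso_eta yw2 syw)).
apply: (iso_cancel_right (iso_eta zx1 szx)).
rewrite -(ccompA _ (_ \oc tx)) -(ccompA _ tx) Ez !ccompA Ew -!fmap_comp.
by congr fmap; apply: code_inj; rewrite !code_eta.
Qed.

End CellComparison.

Variables (I : cideal C) (M : set (pobj Q)) (hM : sample PP M).
Local Notation A := (Abar I PP).
Local Notation iota := (inclF (C := A) M).
Local Notation r := (retraction hPP I hM).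

Lemma nat_iso_retraction_incl : nat_iso (compF r iota) (idF (full_sub (C := A) M)).
Proof.
have [rs rP] := retractionP hPP I hM.
have rE (x : full_sub (C := A) M) : sval (r (sval x)) = sval x.
  apply: (sample_uniq hM _ _ (svalP x)); last exact: svalP.
  exact/same_cell_sym/rs.
(* [r] fixes the points of [M] only up to a proved equality, so eta along this relation replaces a
   transport of identities. *)
have le_rx (x : full_sub (C := A) M) : ole (sval (r (sval x))) (sval x).
  by rewrite rE; exact: ole_refl.
exists (fun x => fmap (Abar_proj I PP) (eta (k := k) (le_rx x))).
split=> [x|x y q].
  suff [g gP] : is_iso (fmap (Abar_proj I PP) (eta (k := k) (le_rx x))) by exists g.
  apply: iso_fmap; move: (rE x) (le_rx x); move: (sval (r _)) => z zx.
  subst z => xx; rewrite (Prop_irrelevance xx (ole_refl _)) eta_idm.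
  by exists (idm _); rewrite ccomp1l.
have [p' [/(pequivP hPP)[_ _ Ep'] rp']] := rP _ _ (qrepr q).
have qE : fmap (Abar_proj I PP) (qrepr q) = q by exact: qreprK.
have E : eta (k := k) (le_rx y) \oc p' = qrepr q \oc eta (k := k) (le_rx x).
  apply: code_inj; rewrite -[_ \oc p']ccomp1r -eta_idm code_eta.
  by rewrite -[_ \oc eta _]ccomp1l ccompA -[idm _]eta_idm code_eta.
have := congr1 (fun f => fmap (Abar_proj I PP) f) E.
by rewrite !fmap_comp -rp' qE.
Qed.

(** The components compare the sample point of each cell with the other points of that cell. They
    are natural because [r] sends a morphism to the class of one with the same code. *)
Lemma nat_iso_incl_retraction (L : linCat k) (F : linFunctor A L) :
  inverts F (Sigma_bar I PP) -> nat_iso (compF (compF F iota) r) F.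
Proof.
move=> FS; have [rs rP] := retractionP hPP I hM.
pose FC := compF F (Abar_proj I PP).
have FCS : inverts FC (Sigma k PP) by move=> x y f Sf; apply: FS; exists f.
pose t x := cell_comparison_exists FCS (same_cell_sym (rs x)).
exists (fun x => sval (t x)); split=> [x|x y q]; first by have [] := svalP (t x).
have [p' [/(pequivP hPP)[_ _ Ep'] rp']] := rP _ _ (qrepr q).
have qE : fmap (Abar_proj I PP) (qrepr q) = q by exact: qreprK.
rewrite -qE /= rp'.
have [_ tx] := svalP (t x); have [_ ty] := svalP (t y).
exact: (cell_comparison_natural FCS tx ty (esym Ep')).
Qed.

End ThreadQuiver.

Theorem proposition3p6 (k : closedFieldType) (d : Order.disp_t)
    (Q : threadQuiver d) (I : cideal (pathCat Q k))
    (PP : set (set (pobj Q))) (hPP : valid_partition PP)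
    (M : set (pobj Q)) (hM : sample PP M)
    (L : linCat k) (pi : linFunctor (Abar I PP) L)
    (hpi : is_localization (Sigma_bar I PP) pi) :
  quasi_inverse (compF pi (inclF (C := Abar I PP) M)) (Phi hPP hM hpi).
Proof.
split.
  by rewrite compFA PhiP; exact: nat_iso_retraction_incl.
apply: (localization_nat_iso hpi); rewrite -compFA PhiP.
exact: (nat_iso_incl_retraction _ hM hpi.1).
Qed.
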